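(* Let $n\ge 2$ and let $\Gamma_{n-1}\subset\Gamma_n$ be an inclusion of Coxeter graphs of spherical type with vertex sets $\{x_1,\dots,x_{n-1}\}$ and $\{x_1,\dots,x_n\}$ respectively. Let $R_n=\Delta(\Gamma_n,\Gamma_{n-1})$ be the relative Garside element, let $\sigma_n$ be the bijection of $\{1,\dots,n\}$ with $x_i\Delta(\Gamma_n)=\Delta(\Gamma_n)x_{\sigma_n(i)}$, let $m=\sigma_n(n)$, and let $\sigma:\{1,\dots,n-1\}\to\{1,\dots,n\}\setminus\{m\}$ be the bijection with $x_iR_n=R_nx_{\sigma(i)}$. Suppose $U_n\in\mathcal{M}(\Gamma_n)$ satisfies: (a) $x_n\mid_L U_n$; (b) there are $k\in\{1,\dots,n\}$ and a bijection $\tau:\{1,\dots,n-1\}\to\{1,\dots,n\}\setminus\{k\}$ such that $x_iU_n=U_nx_{\tau(i)}$ for all $i\in\{1,\dots,n-1\}$; (c) $U_n$ has minimal length among the elements of $\mathcal{M}(\Gamma_n)$ satisfying (a) and (b). Then $U_n=R_n$ (and also $k=m$ and $\tau=\sigma$).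
   Context: A Coxeter matrix over a set $S$ is $M=(m_{st})_{s,t\in S}$ with $m_{ss}=1$ and $m_{st}=m_{ts}\in\{2,3,4,\dots,\infty\}$ for $s\ne t$; its Coxeter graph $\Gamma$ has vertex set $S$, an edge between $s,t$ when $m_{st}\ge3$, labelled by $m_{st}$ when $m_{st}\ge4$. The Artin monoid $\mathcal{M}(\Gamma)$ is the monoid generated by $S$ with relations $\underbrace{sts\cdots}_{m_{st}}=\underbrace{tst\cdots}_{m_{st}}$ for all $s\ne t$ with $m_{st}\neq\infty$. The relations are homogeneous, so every element has a well-defined length (number of generators in any word representing it). $\Gamma$ is of spherical type if the Coxeter group (obtained by adding the relations $s^2=1$) is finite. An inclusion $\Gamma_{n-1}\subset\Gamma_n$ means that $\Gamma_{n-1}$ is the full labelled subgraph of $\Gamma_n$ on the vertices $x_1,\dots,x_{n-1}$ (so $\Gamma_n$ has one new vertex $x_n$); $\mathcal{M}(\Gamma_{n-1})$ is regarded as the submonoid of $\mathcal{M}(\Gamma_n)$ generated by $x_1,\dots,x_{n-1}$. Left divisibility in a monoid: $\alpha\mid_L\beta$ means $\beta=\alpha\rho$ for some $\rho$. For $\Gamma$ of spherical type, the Garside element $\Delta(\Gamma)\in\mathcal{M}(\Gamma)$ is the unique element such that $s\mid_L\Delta(\Gamma)$ for every generator $s$, and whenever $s\mid_L\omega$ for all generators $s$ then $\Delta(\Gamma)\mid_L\omega$. One has $\Delta(\Gamma_{n-1})\mid_L\Delta(\Gamma_n)$, and the relative Garside element $R_n=\Delta(\Gamma_n,\Gamma_{n-1})$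 is the (unique, by cancellativity) element with $\Delta(\Gamma_n)=\Delta(\Gamma_{n-1})\,R_n$. It is a known fact that conjugation by the Garside element permutes the generators, which gives the bijection $\sigma_n$; the bijection $\sigma$ exists and is $\sigma=\sigma_n\circ\sigma_{n-1}^{-1}$, where $\sigma_{n-1}$ is the analogous bijection of $\{1,\dots,n-1\}$ for $\Delta(\Gamma_{n-1})$. *)

(* Defs.v *)
From HB Require Import structures.
From mathcomp Require Import all_boot perm.
From mathcomp Require Import boolp classical_sets functions cardinality.

Set Implicit Arguments.
Unset Strict Implicit.
Unset Printing Implicit Defensive.

Local Open Scope group_scope.
Local Open Scope quotient_scope.

Section PresentedMonoid.
Variables (S : choiceType) (r : seq S -> seq S -> Prop).

Inductive word_cong : seq S -> seq S -> Prop :=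
| word_cong_step u a b v : r a b -> word_cong (u ++ a ++ v) (u ++ b ++ v)
| word_cong_refl u : word_cong u u
| word_cong_sym u v : word_cong u v -> word_cong v u
| word_cong_trans u v w : word_cong u v -> word_cong v w -> word_cong u w.

Definition word_eq : rel (seq S) := fun u v => `[< word_cong u v >].

Lemma word_eq_refl : reflexive word_eq.
Proof. by move=> u; apply/asboolP; apply: word_cong_refl. Qed.

Lemma word_eq_sym : symmetric word_eq.
Proof. by move=> u v; apply/asboolP/asboolP; apply: word_cong_sym. Qed.

Lemma word_eq_trans : transitive word_eq.
Proof.
by move=> v u w /asboolP uv /asboolP vw; apply/asboolP;
  apply: word_cong_trans uv vw.
Qed.

Canonical word_equiv := EquivRel word_eq word_eq_refl word_eq_sym word_eq_trans.

(* The monoid generated by S subject to the relations a = b for r a b. *)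
Definition presMonoid := {eq_quot word_equiv}.

HB.instance Definition _ := Choice.on presMonoid.
HB.instance Definition _ := EqQuotient.on presMonoid.

Implicit Types (u v w : seq S) (x y z : presMonoid).

Definition pres u : presMonoid := \pi_presMonoid u.

Lemma presE u v : pres u = pres v <-> word_cong u v.
Proof.
rewrite /pres; split=> [/eqmodP/asboolP //|uv].
by apply/eqmodP/asboolP.
Qed.

Lemma pres_repr x : pres (repr x) = x.
Proof. exact: reprK. Qed.

Lemma repr_pres u : word_cong (repr (pres u)) u.
Proof. by apply/presE; rewrite pres_repr. Qed.

Lemma word_cong_cat u u' v v' :
  word_cong u u' -> word_cong v v' -> word_cong (u ++ v) (u' ++ v').
Proof.
move=> uu' vv'; apply: (@word_cong_trans _ (u' ++ v)).
  elim: uu' {vv'} => [w a b w' ab|w|w w' _|w1 w2 w3 _ h1 _ h2].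
  - by rewrite -!catA; apply: word_cong_step.
  - exact: word_cong_refl.
  - exact: word_cong_sym.
  - exact: word_cong_trans h1 h2.
elim: vv' {uu'} => [w a b w' ab|w|w w' _|w1 w2 w3 _ h1 _ h2].
- by rewrite !(catA u'); apply: word_cong_step.
- exact: word_cong_refl.
- exact: word_cong_sym.
- exact: word_cong_trans h1 h2.
Qed.

Definition pres_mul x y : presMonoid := pres (repr x ++ repr y).

Lemma pres_cat u v : pres (u ++ v) = pres_mul (pres u) (pres v).
Proof.
by apply/presE; apply: word_cong_sym; apply: word_cong_cat; apply: repr_pres.
Qed.

Lemma pres_mulA : associative pres_mul.
Proof.
by move=> x y z; rewrite -(pres_repr x) -(pres_repr y) -(pres_repr z)
  -!pres_cat catA.
Qed.

Lemma pres_mul1 : left_id (pres [::]) pres_mul.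
Proof. by move=> x; rewrite -(pres_repr x) -pres_cat. Qed.

Lemma pres_mulr1 : right_id (pres [::]) pres_mul.
Proof. by move=> x; rewrite -(pres_repr x) -pres_cat cats0. Qed.

HB.instance Definition _ :=
  isMonoid.Build presMonoid pres_mulA pres_mul1 pres_mulr1.

Lemma pres_catM u v : pres (u ++ v) = pres u * pres v.
Proof. exact: pres_cat. Qed.

Definition gen (s : S) : presMonoid := pres [:: s].

End PresentedMonoid.

(* None encodes the label oo. *)
Record coxeterMatrix (S : Type) := CoxeterMatrix {
  cox_label :> S -> S -> option nat;
  cox_diag : forall s, cox_label s s = Some 1%N;
  cox_sym : forall s t, cox_label s t = cox_label t s;
  cox_ge2 : forall s t k, s <> t -> cox_label s t = Some k -> (2 <= k)%N
}.

(* The word s t s t ... with k letters. *)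
Definition alternating (S : Type) (s t : S) (k : nat) : seq S :=
  mkseq (fun i => if odd i then t else s) k.

Section Artin.
Variables (S : choiceType) (M : coxeterMatrix S).

Inductive braid_relation : seq S -> seq S -> Prop :=
| BraidRelation s t k : s <> t -> M s t = Some k ->
    braid_relation (alternating s t k) (alternating t s k).

Inductive coxeter_relation : seq S -> seq S -> Prop :=
| CoxeterBraid a b : braid_relation a b -> coxeter_relation a b
| CoxeterSquare s : coxeter_relation [:: s; s] [::].

Definition artinMonoid := presMonoid braid_relation.
HB.instance Definition _ := Monoid.on artinMonoid.

(* Presented as a monoid: since s^2 = 1, every generator is invertible, so this
   is also the group with the same presentation. *)
Definition coxeterGroup := presMonoid coxeter_relation.
HB.instance Definition _ := Monoid.on coxeterGroup.

Definition coxeter_inv (x : coxeterGroup) : coxeterGroup :=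
  pres coxeter_relation (rev (repr x)).

Lemma pres_rev_mul u :
  (pres coxeter_relation (rev u) * pres coxeter_relation u = 1) *
  (pres coxeter_relation u * pres coxeter_relation (rev u) = 1).
Proof.
have red v s w : pres coxeter_relation (v ++ [:: s; s] ++ w) =
                 pres coxeter_relation (v ++ w).
  by apply/presE; rewrite -[v ++ w]/(v ++ [::] ++ w);
    apply: word_cong_step; apply: CoxeterSquare.
rewrite -!pres_catM; split.
  elim: u => [//|s u IH].
  by rewrite rev_cons -cats1 -catA /= (red (rev u) s u).
elim/last_ind: u => [//|u s IH].
by rewrite rev_rcons -cats1 -catA /= (red u s (rev u)).
Qed.

Lemma coxeter_mulVg : left_inverse 1 coxeter_inv (@mul coxeterGroup).
Proof. by move=> x; rewrite -{2}(pres_repr x); apply: (pres_rev_mul _).1. Qed.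

Lemma coxeter_mulgV : right_inverse 1 coxeter_inv (@mul coxeterGroup).
Proof. by move=> x; rewrite -{1}(pres_repr x); apply: (pres_rev_mul _).2. Qed.

HB.instance Definition _ := hasInv.Build coxeterGroup coxeter_inv.
HB.instance Definition _ :=
  Monoid_isGroup.Build coxeterGroup coxeter_mulVg coxeter_mulgV.

Definition spherical : Prop := finite_set [set: coxeterGroup]%classic.

Definition agen (s : S) : artinMonoid := gen braid_relation s.

(* Independent of the chosen representative, by alength_pres. *)
Definition alength (x : artinMonoid) : nat := size (repr x).

Lemma alength_pres u : alength (pres braid_relation u) = size u.
Proof.
suff sizeE v w : word_cong braid_relation v w -> size v = size w.
  exact: sizeE (repr_pres _ u).
elim=> [v1 a b w1 ab|//|v1 w1 _ -> //|v1 w1 z _ -> //].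
by case: ab => s t k _ _; rewrite !size_cat !size_mkseq.
Qed.

Definition ldiv (x y : artinMonoid) : Prop := exists z, y = x * z.

Definition is_garside (d : artinMonoid) : Prop :=
  (forall s, ldiv (agen s) d) /\
  (forall w, (forall s, ldiv (agen s) w) -> ldiv d w).

End Artin.

(* The monoid morphism induced by a map of generators; see artin_map_pres for
   its values when f preserves labels. *)
Definition artin_map (S T : choiceType) (M : coxeterMatrix S)
    (N : coxeterMatrix T) (f : S -> T) (x : artinMonoid M) : artinMonoid N :=
  pres (braid_relation N) (map f (repr x)).

Lemma artin_map_pres (S T : choiceType) (M : coxeterMatrix S)
    (N : coxeterMatrix T) (f : S -> T) (u : seq S) :
  injective f -> (forall s t, N (f s) (f t) = M s t) ->
  artin_map N f (pres (braid_relation M) u) =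
  pres (braid_relation N) (map f u).
Proof.
move=> finj fM; apply/presE.
suff mapE v w : word_cong (braid_relation M) v w ->
    word_cong (braid_relation N) (map f v) (map f w).
  exact: mapE (repr_pres _ u).
elim=> {u v w} [v a b w ab|v|v w _ |v w z _ h1 _ h2].
- rewrite !map_cat; apply: word_cong_step; case: ab => s t k st Mst.
  have altE x y : map f (alternating x y k) = alternating (f x) (f y) k.
    by rewrite /alternating /mkseq -map_comp; apply: eq_map => i /=; case: odd.
  by rewrite !altE; apply: BraidRelation; [move=> /finj | rewrite fM].
- exact: word_cong_refl.
- exact: word_cong_sym.
- exact: word_cong_trans h1 h2.
Qed.

Section Inclusion.
Variable n : nat.

(* Vertices are numbered from 0: x_1, ..., x_{n+1} are the elements of
   'I_n.+1, the new vertex x_{n+1} is ord_max, and old embeds x_1, ..., x_n. *)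
Definition old : 'I_n -> 'I_n.+1 := widen_ord (leqnSn n).

Definition full_subgraph (M' : coxeterMatrix 'I_n) (M : coxeterMatrix 'I_n.+1) :
    Prop :=
  forall i j, M (old i) (old j) = M' i j.

Definition artin_incl (M' : coxeterMatrix 'I_n) (M : coxeterMatrix 'I_n.+1) :
    artinMonoid M' -> artinMonoid M :=
  artin_map M old.

Definition conj_old (M : coxeterMatrix 'I_n.+1) (U : artinMonoid M)
    (k : 'I_n.+1) (t : 'I_n -> 'I_n.+1) : Prop :=
  set_bij [set: 'I_n]%classic [set~ k]%classic t /\
  forall i, agen M (old i) * U = U * agen M (t i).

End Inclusion.

(* Main.v *)
Require Import Defs.
From HB Require Import structures.
From mathcomp Require Import all_boot perm.
From mathcomp Require Import ssralg ssrnum poly algC cyclotomic.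
From mathcomp Require Import ring.
From mathcomp Require Import boolp classical_sets functions cardinality.

Set Implicit Arguments.
Unset Strict Implicit.
Unset Printing Implicit Defensive.

Import GRing.Theory Num.Theory.
Local Open Scope group_scope.

(** The theorem follows from left cancellation in the Artin monoid, together
with the fact that the lcm of two generators s <> t, when they have a common
multiple at all, is the braid word s t s ... of length m_st (both are in
[artin_lcm_property]).

Write D' for the Garside element of the smaller graph, so that D = D' R.
If U satisfies (a) and (b), moving U across D' letter by letter gives
D' U = U D'' for some D''; hence D' U is left divisible by the old generators,
which divide D', and by the new one, which divides U.  So D divides D' U, and
cancelling D' shows that R divides U.  Conversely R itself satisfies (a): the
new generator divides D = D' R, and it can be moved past the old letters of D'
one at a time, because a generator t that divides s X with s <> t also divides
X ([agen_ldiv_mul]).  Since R satisfies (b) as well, minimality of U forces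
U = R, and cancelling R in x_i R = R x_(tau i) = R x_(sigma i) identifies the
bijections.

Cancellation and the lcm property are proved for every Coxeter matrix, with no
classification of the rank 3 subgraphs, by comparison with the Coxeter group.
- The reflection representation, over the algebraic numbers with entries
  z + 1/z for z a primitive root of unity of order 2 m_st, shows that the
  product s t has order exactly m_st in the group.
- The list of reflections attached to a word, counted mod 2, depends only on
  the group element ([inverts_cox]); this gives the exchange condition, the
  fact that an element with two left descents s, t starts with the braid word
  of s and t ([dihedral_prefix]), its counterpart for two right ascents
  ([reduced_cat_dihedral]), and Matsumoto's theorem ([matsumoto]).
- The lcm property is an induction on length.  A chain of braid moves from a
  word s X to a word t Y changes the first letter now and then, and the only
  problem is to compose two such changes, s X = t Y = u Z
  ([lcm_factor_trans]).  The words z such that t z is reduced and z divides Y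
  form a confluent system ([admissible_confluence]), so that one reduced word
  t z dividing t Y is divisible by both s and u.  In the Coxeter group that
  word starts with the braid word of s and u, and Matsumoto's theorem brings
  this back to the monoid. *)

(** * Alternating words *)
Section Alternating.
Variable S : Type.
Implicit Types s t : S.

Lemma size_alternating s t k : size (alternating s t k) = k.
Proof. exact: size_mkseq. Qed.

Lemma alternatingS s t k : alternating s t k.+1 = s :: alternating t s k.
Proof.
rewrite /alternating /mkseq -[iota 0 k.+1]/(0%N :: iota 1 k) map_cons.
rewrite (iotaDl 1 0) -map_comp; congr cons; apply: eq_map => i /=.
by case: (odd i).
Qed.

Lemma alternatingSr s t k :
  alternating s t k.+1 = rcons (alternating s t k) (if odd k then t else s).
Proof. by rewrite /alternating mkseqS. Qed.

End Alternating.

(** * Chebyshev polynomials *)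
Section Chebyshev.
Local Open Scope ring_scope.
Implicit Types (q z a b : algC).

(** Chebyshev polynomials of the second kind, shifted and normalized so that
[cheb (2 cos a) k] is sin (k a) / sin a: the matrix coefficients of the powers
of a product of two reflections. *)
Fixpoint cheb q k : algC :=
  if k is k'.+1 then
    if k' is k''.+1 then q * cheb q k' - cheb q k'' else 1
  else 0.

Lemma chebSS q k : cheb q k.+2 = q * cheb q k.+1 - cheb q k.
Proof. by []. Qed.

Lemma cheb_exp z k :
  z != 0 -> (z - z^-1) * cheb (z + z^-1) k = z ^+ k - z^-1 ^+ k.
Proof.
move=> z0; have zV : z * z^-1 = 1 by rewrite divff.
elim/ltn_ind: k => -[|[|k]] IH; first by rewrite /= mulr0 !expr0 subrr.
  by rewrite /= mulr1 !expr1.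
rewrite chebSS mulrBr mulrCA IH // IH // !exprS.
move: (z^-1) zV (z ^+ k) => y zV x; ring: zV.
Qed.

Lemma cheb2 k : cheb 2 k = k%:R.
Proof.
elim/ltn_ind: k => -[|[|k]] IH //.
by rewrite chebSS !IH // -[k.+2]addn2 -[k.+1]addn1 !natrD; ring.
Qed.

(** The coefficient of the first letter of an alternating word in its action on
the reflection representation, as computed in [act_alternating]. *)
Definition cheb_sum q a b k : algC :=
  \sum_(i < k) cheb q i.+1 * (if odd i then b else a).

Lemma cheb_sumS q a b k :
  cheb_sum q a b k.+1 =
  cheb_sum q a b k + cheb q k.+1 * (if odd k then b else a).
Proof. by rewrite /cheb_sum big_ord_recr. Qed.

Lemma cheb_sum_rec q a b k :
  cheb_sum q a b k.+1 = a + q * cheb_sum q b a k - cheb_sum q a b k.-1.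
Proof.
elim: k => [|k IH]; first by rewrite cheb_sumS /cheb_sum !big_ord0 /=; ring.
rewrite cheb_sumS IH cheb_sumS chebSS.
case: k {IH} => [|k]; first by rewrite /cheb_sum !big_ord0 /=; ring.
rewrite -!pred_Sn [cheb_sum q a b k.+1]cheb_sumS !oddS negbK.
by move: (cheb q k.+2) (cheb q k.+1) => x y; case: odd => /=; ring.
Qed.

Lemma prim_root_subV_neq0 n z :
  n.-primitive_root z -> (2 < n)%N -> z - z^-1 != 0.
Proof.
move=> prz n2.
have z0 : z != 0 by rewrite (prim_root_eq0 prz); case: n n2 {prz}.
apply/eqP => /eqP; rewrite subr_eq0 => /eqP /(congr1 ( *%R z)).
rewrite divff // => /eqP; rewrite -expr2 -(prim_order_dvd prz).
by move/dvdn_leq => /(_ isT); rewrite leqNgt n2.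
Qed.

End Chebyshev.

(** * The reflection representation and the order of s t *)
Section ReflectionRepresentation.
Variables (S : choiceType) (M : coxeterMatrix S).
Local Open Scope ring_scope.
Implicit Types (s t u : S) (f : S -> algC).

Definition dihedral_root m : algC :=
  sval (C_prim_root_exists (ltn0Sn (2 * m).-1)).

Lemma dihedral_rootP m :
  (0 < m)%N -> (2 * m)%N.-primitive_root (dihedral_root m).
Proof.
by case: m => // m _; rewrite /dihedral_root; case: C_prim_root_exists.
Qed.

(** The algebraic form of - 2 B(s, t) for the Tits form B: the value
2 cos (pi/m) is z + 1/z, and any primitive root z of order 2m serves. *)
Definition cartan s t : algC :=
  if s == t then - 2 else
  if M s t is Some m then dihedral_root m + (dihedral_root m)^-1 else 2.

Lemma cartanss s : cartan s s = - 2.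
Proof. by rewrite /cartan eqxx. Qed.

Lemma cartan_sym s t : cartan s t = cartan t s.
Proof. by rewrite /cartan cox_sym eq_sym. Qed.

Lemma cheb_cartan_eq0 s t m : s <> t -> M s t = Some m ->
  cheb (cartan s t) m = 0.
Proof.
move=> st Mst; have m2 := cox_ge2 st Mst; have m0 := ltnW m2.
have prz := dihedral_rootP m0; rewrite /cartan Mst; case: eqP => // _.
move: (dihedral_root m) prz => z prz.
have z0 : z != 0 by rewrite (prim_root_eq0 prz) muln_eq0 -lt0n.
have dz : z - z^-1 != 0.
  by apply: prim_root_subV_neq0 prz _; rewrite -{1}[2%N]muln1 ltn_mul2l.
apply: (mulfI dz); rewrite mulr0 cheb_exp // exprVn.
apply/eqP; rewrite subr_eq0; apply/eqP; apply: (mulfI (expf_neq0 m z0)).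
by rewrite divff ?expf_neq0 // -exprD addnn -mul2n prim_expr_order.
Qed.

(** Up to the factor z - 1/z, the two hypotheses say z^(2j) = z^(-2j) and
z^(2j+1) - z^(-2j-1) = z - 1/z; together they force z^(2j) = 1, which is
stronger than what the first one alone would give.  For an infinite label z is
1 and the first hypothesis fails, by [cheb2]. *)
Lemma cheb_cartan_period s t j : s <> t -> (0 < j)%N ->
  cheb (cartan s t) (2 * j) = 0 -> cheb (cartan s t) (2 * j).+1 = 1 ->
  exists2 m, M s t = Some m & (m <= j)%N.
Proof.
move=> st j0; rewrite /cartan; case: eqP => // _.
case Mst: (M s t) => [m|]; last first.
  by rewrite cheb2 => /eqP; rewrite pnatr_eq0 muln_eq0 /= eqn0Ngt j0.
move=> c0 c1; exists m => //.
have m0 : (0 < m)%N := ltnW (cox_ge2 st Mst).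
have prz := dihedral_rootP m0; move: (dihedral_root m) prz c0 c1 => z prz.
have z0 : z != 0 by rewrite (prim_root_eq0 prz) muln_eq0 -lt0n.
have dz : z - z^-1 != 0.
  apply: prim_root_subV_neq0 prz _; rewrite -{1}[2%N]muln1 ltn_mul2l.
  exact: cox_ge2 st Mst.
move/(congr1 ( *%R (z - z^-1))); rewrite mulr0 cheb_exp // => /eqP.
rewrite subr_eq0 => /eqP zN /(congr1 ( *%R (z - z^-1))).
rewrite mulr1 cheb_exp // !exprS -zN -mulrBl => /eqP.
rewrite -subr_eq0 -{2}[z - z^-1]mulr1 -mulrBr mulf_eq0 (negPf dz) subr_eq0 /=.
rewrite -(prim_order_dvd prz) dvdn_pmul2l //; exact: dvdn_leq.
Qed.

(** The action on functions on the vertices, dual to the usual one on the span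
of the simple roots: it makes sense for an infinite graph too. *)
Definition reflect s f : S -> algC := fun u => f u + cartan u s * f s.

Definition act (w : seq S) f := foldr reflect f w.

Lemma act_cat v w f : act (v ++ w) f = act v (act w f).
Proof. exact: foldr_cat. Qed.

Lemma act_alternating s t k f u : act (alternating s t k) f u =
  f u + cartan u s * cheb_sum (cartan s t) (f s) (f t) k +
        cartan u t * cheb_sum (cartan s t) (f t) (f s) k.-1.
Proof.
elim: k s t u => [|k IH] s t u; first by rewrite /= /cheb_sum !big_ord0; ring.
rewrite alternatingS /= /reflect !IH (cartan_sym t s) cartanss.
by rewrite (cheb_sum_rec _ (f s)); ring.
Qed.

(** In the formula of [act_alternating], the two sides differ by multiples of
the last term of each sum, whose coefficient is [cheb (cartan s t) m = 0]. *)
Lemma act_braid s t m f : s <> t -> M s t = Some m ->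
  act (alternating s t m) f = act (alternating t s m) f.
Proof.
move=> st Mst; have c0 := cheb_cartan_eq0 st Mst.
apply/funext => u; rewrite !act_alternating (cartan_sym t s).
case: m Mst c0 => [/(cox_ge2 st)//|m _ c0].
by rewrite !cheb_sumS c0 succnK; ring.
Qed.

Lemma act_square s f : act [:: s; s] f = f.
Proof. by apply/funext => u; rewrite /= /reflect cartanss; ring. Qed.

Lemma act_coxeter v w : word_cong (coxeter_relation M) v w -> act v = act w.
Proof.
elim=> {v w} [u a b v ab|//|v w _ -> //|u v w _ -> //].
apply/funext => f; rewrite !act_cat; congr act.
case: ab => [_ _ [s t k st Mst]|s]; [exact: act_braid | exact: act_square].
Qed.

(** Evaluation at t alone suffices to read off the order of s t, since both
relevant Chebyshev coefficients occur in it. *)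
Lemma act_rotation s t j f :
  act (alternating s t (2 * j.+1)) f t =
  cheb (cartan s t) (2 * j.+1).+1 * f t + cheb (cartan s t) (2 * j.+1) * f s.
Proof.
rewrite act_alternating cartanss (cartan_sym t s).
set q := cartan s t; set a := f s; set b := f t; set k := (2 * j.+1)%N.
have k_even : odd k = false by rewrite oddM.
have := cheb_sum_rec q b a k; rewrite cheb_sumS k_even => h.
have {h} -> : q * cheb_sum q a b k =
    cheb_sum q b a k + cheb q k.+1 * b + cheb_sum q b a k.-1 - b.
  by rewrite h; ring.
rewrite -[k]prednK // [cheb_sum q b a k.-1.+1]cheb_sumS -pred_Sn.
by rewrite -[odd k.-1]negbK -oddS prednK // k_even /=; ring.
Qed.

End ReflectionRepresentation.

(** * Words in the Coxeter group and their reflections *)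
Section CoxeterWords.
Variables (S : choiceType) (M : coxeterMatrix S).
Local Notation W := (coxeterGroup M).
Implicit Types (s t p q : S) (u v w : seq S) (r : W).

Definition cox u : W := pres (coxeter_relation M) u.

Lemma coxE u v : cox u = cox v <-> word_cong (coxeter_relation M) u v.
Proof. exact: presE. Qed.

Lemma cox_cat u v : cox (u ++ v) = cox u * cox v.
Proof. exact: pres_catM. Qed.

Lemma cox_nil : cox [::] = 1.
Proof. by []. Qed.

Lemma cox_cons s u : cox (s :: u) = cox [:: s] * cox u.
Proof. exact: (cox_cat [:: s]). Qed.

Lemma cox_rcons u s : cox (rcons u s) = cox u * cox [:: s].
Proof. by rewrite -cats1 cox_cat. Qed.

Lemma cox_rev u : cox (rev u) = (cox u)^-1.
Proof.
by apply/esym/mulg1_eq; apply: (pres_rev_mul M u).2.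
Qed.

Lemma cox_sq s : cox [:: s] * cox [:: s] = 1.
Proof. exact: (pres_rev_mul M [:: s]).2. Qed.

Lemma coxV s : (cox [:: s])^-1 = cox [:: s].
Proof. by rewrite -cox_rev. Qed.

Lemma cox_mulK s x : cox [:: s] * (cox [:: s] * x) = x.
Proof. by rewrite mulgA cox_sq mul1g. Qed.

Lemma cox_braid s t m : s <> t -> M s t = Some m ->
  cox (alternating s t m) = cox (alternating t s m).
Proof.
move=> st Mst; apply/coxE.
rewrite -[alternating s t m]cats0 -[alternating t s m]cats0.
exact: (@word_cong_step _ _ [::]) (CoxeterBraid (BraidRelation st Mst)).
Qed.

Lemma rotation_inv s t :
  cox [:: t] * cox [:: s] = (cox [:: s] * cox [:: t])^-1.
Proof. by rewrite invgM !coxV. Qed.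

Lemma cox_alternating_even s t j :
  cox (alternating s t (2 * j)) = (cox [:: s] * cox [:: t]) ^+ j.
Proof.
elim: j => [//|j IH]; rewrite mulnS add2n !alternatingS cox_cons (cox_cons t).
by rewrite IH expgS mulgA.
Qed.

Lemma cox_alternating_odd s t j :
  cox (alternating s t (2 * j).+1) =
  (cox [:: s] * cox [:: t]) ^+ j * cox [:: s].
Proof.
by rewrite alternatingSr oddM /= cox_rcons cox_alternating_even.
Qed.

(** A power of s t that is trivial in the group acts trivially, and applying it
to the indicator functions of s and of t gives the two equations required by
[cheb_cartan_period]. *)
Lemma rotation_order s t j : s <> t -> (0 < j)%N ->
  (cox [:: s] * cox [:: t]) ^+ j = 1 ->
  exists2 m, M s t = Some m & (m <= j)%N.
Proof.
case: j => // j st _; rewrite -cox_alternating_even -cox_nil.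
move=> /coxE/act_coxeter actE.
have h f : (f t = cheb (cartan M s t) (2 * j.+1).+1 * f t +
                  cheb (cartan M s t) (2 * j.+1) * f s)%R.
  by rewrite -act_rotation actE.
apply: (cheb_cartan_period st) => //.
  have := h (fun x : S => if x == s then 1%R else 0%R).
  by rewrite eqxx eq_sym (introF eqP st) mulr0 add0r mulr1.
have := h (fun x : S => if x == t then 1%R else 0%R).
by rewrite eqxx (introF eqP st) mulr0 addr0 mulr1.
Qed.

Lemma rotation_shift s t k :
  cox [:: s] * ((cox [:: t] * cox [:: s]) ^+ k * cox [:: t]) =
  (cox [:: s] * cox [:: t]) ^+ k.+1.
Proof.
elim: k => [|k IH]; first by rewrite expg0 mul1g expg1.
by rewrite expgSr [RHS]expgSr -IH -!mulgA.
Qed.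

Lemma alternating_braid_rotation s t k :
  cox (alternating s t k) = cox (alternating t s k) ->
  (cox [:: s] * cox [:: t]) ^+ k = 1.
Proof.
have rotE : forall s' t', (cox [:: s'] * cox [:: t']) ^+ k =
   cox (alternating s' t' k) / cox (alternating t' s' k).
  elim: k => [|k IH] s' t'; first by rewrite expg0 divgg.
  rewrite !alternatingS !(cox_cons _ (alternating _ _ _)) invgM coxV.
  by rewrite -rotation_shift IH -!mulgA.
by move=> altE; rewrite rotE altE mulgV.
Qed.

(** For u = s_1 ... s_k, the reflections s_1 ... s_(i-1) s_i s_(i-1) ... s_1.
Conjugation by a generator is written without an inverse, generators being
involutions. *)
Fixpoint refls u : seq W :=
  if u is s :: v then
    cox [:: s] :: [seq r ^ cox [:: s] | r <- refls v]
  else [::].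

Lemma size_refls u : size (refls u) = size u.
Proof. by elim: u => //= s u IH; rewrite size_map IH. Qed.

Lemma refls_cat u v :
  refls (u ++ v) = refls u ++ [seq r ^ (cox u)^-1 | r <- refls v].
Proof.
elim: u => [|s u IH] /=.
  by rewrite cox_nil invg1; under eq_map do rewrite conjg1; rewrite map_id.
rewrite IH map_cat -map_comp; congr (_ :: _ ++ _).
by apply: eq_map => r /=; rewrite (cox_cons s u) invgM coxV conjgM.
Qed.

Lemma refls_alternating s t k :
  refls (alternating s t k) =
  mkseq (fun i => cox (alternating s t (2 * i).+1)) k.
Proof.
elim: k s t => // k IH s t; rewrite alternatingS /= IH /mkseq.
rewrite -[iota 0 k.+1]/(0%N :: iota 1 k) map_cons.
rewrite (iotaDl 1 0) -!map_comp; congr cons; apply: eq_map => i /=.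
by rewrite !cox_alternating_odd /conjg coxV mulgA rotation_shift.
Qed.

(** Whether the reflection r separates the identity from u, that is, whether it
is crossed an odd number of times along u. *)
Definition inverts u r := odd (count_mem r (refls u)).

Lemma count_conj r x (l : seq W) :
  count_mem r [seq r' ^ x | r' <- l] = count_mem (r ^ x^-1) l.
Proof.
rewrite count_map; apply: eq_count => r' /=.
by rewrite -[RHS](inj_eq (@conjg_inj _ x)) conjgKV.
Qed.

Lemma inverts_cat u v r :
  inverts (u ++ v) r = inverts u r (+) inverts v (r ^ cox u).
Proof. by rewrite /inverts refls_cat count_cat oddD count_conj invgK. Qed.

(** The two lists are the reversals of each other: with x = s t and x^m = 1, the
i-th reflection x^i s of one is the (m-1-i)-th reflection x^(i+1-m) t of the
other. *)
Lemma perm_refls_braid s t m : s <> t -> M s t = Some m ->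
  perm_eq (refls (alternating s t m)) (refls (alternating t s m)).
Proof.
move=> st Mst; have rot := alternating_braid_rotation (cox_braid st Mst).
rewrite perm_sym -(perm_rev (refls (alternating t s m))).
suff -> : rev (refls (alternating t s m)) = refls (alternating s t m) by [].
rewrite !refls_alternating; apply: (@eq_from_nth _ 1).
  by rewrite size_rev !size_mkseq.
move=> i; rewrite size_rev size_mkseq => im.
rewrite nth_rev ?size_mkseq // !nth_mkseq //; last first.
  by rewrite ltn_subrL (leq_ltn_trans _ im).
rewrite !cox_alternating_odd.
rewrite rotation_inv; apply: (mulIg (cox [:: t])); rewrite -!mulgA cox_sq mulg1.
rewrite -expgSr; move: (_ * _) rot => x rot; rewrite expVgn.
by apply: mulg1_eq; rewrite -expgnDr subnK.
Qed.


(** Both kinds of relations preserve the parities: s s contributes the same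
reflection twice, and the two sides of a braid relation have the same
reflections. *)
Lemma inverts_cox u v : cox u = cox v -> inverts u =1 inverts v.
Proof.
move=> /coxE; elim=> {u v} [u a b v ab|//|u v _ IH r|u v w _ uv _ vw r].
- have cab : cox a = cox b.
    apply/coxE; rewrite -[a]cats0 -[b]cats0.
    exact: (@word_cong_step _ _ [::]).
  have iab : inverts a =1 inverts b.
    case: ab {cab} => [_ _ [s t k st Mst]|s] r.
      by rewrite /inverts (seq.permP (perm_refls_braid st Mst)).
    by rewrite /inverts /= conjgE mulKg addn0 addnn odd_double.
  by move=> r; rewrite !inverts_cat cab iab.
- by rewrite IH.
- by rewrite uv.
Qed.

(** A word without repeated reflections has minimal length among the words for
its group element, because its reflections are those crossed an odd number of
times, hence belong to the list of every other word for that element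
([reduced_sub], [reduced_size_le]). *)
Definition reduced u := uniq (refls u).

Lemma inverts_mem u r : inverts u r -> r \in refls u.
Proof. by rewrite /inverts -has_pred1 has_count; case: (count _ _). Qed.

Lemma reduced_inverts u r : reduced u -> inverts u r = (r \in refls u).
Proof. by rewrite /inverts => /count_uniq_mem ->; case: (_ \in _). Qed.

Lemma reduced_sub u v :
  reduced u -> cox u = cox v -> {subset refls u <= refls v}.
Proof.
by move=> ru /inverts_cox uv r; rewrite -(reduced_inverts r ru) uv;
  apply: inverts_mem.
Qed.

Lemma reduced_size_le u v : reduced u -> cox u = cox v -> (size u <= size v)%N.
Proof.
move=> ru uv; rewrite -!size_refls; exact: uniq_leq_size ru (reduced_sub ru uv).
Qed.

Lemma reduced_of_size u v :
  reduced u -> cox u = cox v -> (size v <= size u)%N -> reduced v.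
Proof.
move=> ru uv vu; apply: (leq_size_uniq ru (reduced_sub ru uv)).
by rewrite !size_refls.
Qed.

Lemma reduced_size u v :
  reduced u -> reduced v -> cox u = cox v -> size u = size v.
Proof.
move=> ru rv uv; apply/eqP; rewrite eqn_leq.
by rewrite (reduced_size_le ru uv) (reduced_size_le rv (esym uv)).
Qed.

Lemma reduced_mem u v : reduced u -> reduced v -> cox u = cox v ->
  refls u =i refls v.
Proof.
move=> ru rv uv r; apply/idP/idP; exact: reduced_sub.
Qed.

Lemma reduced_catl u v : reduced (u ++ v) -> reduced u.
Proof. by rewrite /reduced refls_cat cat_uniq => /andP[]. Qed.

Lemma reduced_catr u v : reduced (u ++ v) -> reduced v.
Proof.
rewrite /reduced refls_cat cat_uniq => /and3P[_ _].
by rewrite map_inj_uniq //; apply: conjg_inj.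
Qed.

Lemma reduced_cons s u : reduced (s :: u) -> reduced u.
Proof. exact: (@reduced_catr [:: s]). Qed.

Lemma reflsP u r : r \in refls u ->
  exists u1 t u2, u = u1 ++ t :: u2 /\ r = cox [:: t] ^ (cox u1)^-1.
Proof.
elim: u r => //= s u IH r; rewrite inE => /predU1P[->|].
  by exists [::], s, u; rewrite cox_nil invg1 conjg1.
case/mapP=> r' /IH[u1 [t [u2 [-> ->]]]] ->; exists (s :: u1), t, u2.
by split=> //; rewrite (cox_cons s u1) invgM coxV conjgM.
Qed.

Lemma refl_mul u1 t u2 :
  cox [:: t] ^ (cox u1)^-1 * cox (u1 ++ t :: u2) = cox (u1 ++ u2).
Proof.
by rewrite !cox_cat (cox_cons t u2) conjgE invgK -!mulgA mulKg cox_mulK.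
Qed.

(** Multiplying by the i-th reflection of a word deletes its i-th letter; this
is the exchange condition. *)
Lemma refls_deletion u r : r \in refls u ->
  exists v, [/\ r * cox u = cox v, (size v).+1 = size u & subseq v u].
Proof.
case/reflsP=> u1 [t [u2 [-> ->]]]; exists (u1 ++ u2); rewrite refl_mul.
by rewrite !size_cat addnS cat_subseq // subseq_cons.
Qed.

(** A repeated reflection can be cancelled by deleting the two letters that
produce it.  The result is a subword, so this applies inside a dihedral
subgroup. *)
Lemma deletion u : ~~ reduced u ->
  exists v, [/\ cox v = cox u, (size v < size u)%N & subseq v u].
Proof.
elim: u => //= s u IH; rewrite /reduced /= negb_and negbK.
case/orP=> [/mapP[r ru e]|].
  have rs : r = cox [:: s].
    by apply: (@conjg_inj _ (cox [:: s])); rewrite -e conjgE mulKg.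
  have [v [uv sz sv]] := refls_deletion ru; exists v.
  split; first by rewrite -uv rs -cox_cons.
    by rewrite /= -sz ltnS leqnSn.
  exact: subseq_trans sv (subseq_cons _ _).
rewrite map_inj_uniq; last exact: conjg_inj.
case/IH=> v [vu sz sv]; exists (s :: v).
by rewrite (cox_cons s u) -vu -cox_cons /= ltnS eqxx.
Qed.

Lemma alternating_prefix s t m k : (m <= k)%N ->
  exists x, alternating s t k = alternating s t m ++ x.
Proof.
move/subnK <-; elim: (k - m)%N => [|j [x IH]].
  by exists [::]; rewrite cats0.
by rewrite addSn alternatingSr IH rcons_cat; eexists.
Qed.

(** Start with u and prepend s and t in turn by exchange.  The deleted letter
either lies beyond the alternating prefix, which then grows, or inside it, and
then s t has finite order bounded by the length of the prefix.  Since the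
prefix cannot outgrow u, the second case occurs. *)
Lemma dihedral_prefix s t u : s <> t -> reduced u ->
  cox [:: s] \in refls u -> cox [:: t] \in refls u ->
  exists m x, [/\ M s t = Some m, cox u = cox (alternating s t m ++ x)
                & reduced (alternating s t m ++ x)].
Proof.
move=> st ru su tu.
suff: forall k, (exists m x, [/\ M s t = Some m,
      cox u = cox (alternating s t m ++ x) & reduced (alternating s t m ++ x)])
    \/ exists x, cox u = cox (alternating s t k ++ x) /\
                 reduced (alternating s t k ++ x).
  (* An alternating prefix longer than u is impossible. *)
  case/(_ (size u).+1) => // -[x [ux rx]]; have := reduced_size ru rx ux.
  rewrite size_cat size_alternating => /eqP.
  by rewrite ltn_eqF // ltnS leq_addr.
move=> k; elim: k s t st su tu => [|k IH] s t st su tu.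
  by right; exists u.
case: (IH t s (nesym st) tu su) => [[m [x [Mts ux rx]]]|[x [ux rx]]].
  left; exists m, x; have Mst : M s t = Some m by rewrite cox_sym.
  have e : cox u = cox (alternating s t m ++ x).
    by rewrite ux !cox_cat (cox_braid st Mst).
  split=> //; apply: reduced_of_size rx _ _; first by rewrite -e -ux.
  by rewrite !size_cat !size_alternating.
move: su; rewrite (reduced_mem ru rx ux) refls_cat mem_cat => /orP[].
  rewrite refls_alternating => /mapP[i].
  rewrite mem_iota add0n => /andP[_ ik] e.
  have rot : (cox [:: t] * cox [:: s]) ^+ i.+1 = 1.
    by rewrite expgSr mulgA -cox_alternating_odd -e cox_sq.
  have [m Mts mi] := rotation_order (nesym st) (ltn0Sn i) rot.
  have [y ky] := alternating_prefix t s (leq_trans mi ik).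
  left; exists m, (y ++ x); have Mst : M s t = Some m by rewrite cox_sym.
  have e' : cox u = cox (alternating s t m ++ y ++ x).
    by rewrite ux ky -catA [LHS]cox_cat [RHS]cox_cat (cox_braid st Mst).
  split=> //; apply: reduced_of_size rx _ _; first by rewrite -e' -ux.
  by rewrite ky !size_cat !size_alternating addnA.
case/mapP=> r rx' e; have [y [xy sz _]] := refls_deletion rx'.
right; exists y.
have e' : cox u = cox (alternating s t k.+1 ++ y).
  have sr : cox (alternating t s k) * r = cox [:: s] * cox (alternating t s k).
    by rewrite e conjgE invgK -!mulgA mulVg mulg1.
  rewrite alternatingS /= cox_cons cox_cat -xy.
  by rewrite (mulgA (cox (alternating t s k))) sr -mulgA cox_mulK -cox_cat.
split=> //; apply: reduced_of_size rx _ _; first by rewrite -e' -ux.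
by rewrite alternatingS /= !size_cat !size_alternating -sz addnS.
Qed.

Lemma alternating_reduced s t k : s <> t ->
  (forall m, M s t = Some m -> (k <= m)%N) -> reduced (alternating s t k).
Proof.
move=> st km; rewrite /reduced refls_alternating.
apply/mkseq_uniqP => i j; rewrite !inE.
wlog ij : i j / (i <= j)%N => [hw ik jk e|].
  by case: (leqP i j) => [|/ltnW] ij; [|symmetry]; apply: hw.
move=> _ jk; rewrite !cox_alternating_odd => /mulIg e.
case: (ltngtP i j) ij => // ij _.
have rot : (cox [:: s] * cox [:: t]) ^+ (j - i) = 1.
  by rewrite expgnFr 1?ltnW // e mulgV.
have [|m Mst mj] := rotation_order st _ rot; first by rewrite subn_gt0.
have := leq_trans (leq_trans jk (km m Mst)) mj.
by rewrite ltnNge leq_subr.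
Qed.

Lemma reduced_rcons_le u v s :
  reduced (rcons u s) -> cox v = cox (rcons u s) -> (size u < size v)%N.
Proof. by move=> ru /esym /(reduced_size_le ru); rewrite size_rcons. Qed.

(** Shortening a ++ e by [deletion] never lengthens a, so a ++ e may be assumed
reduced; then e is empty, since its last letter would shorten y.  Thus y has
minimal length in its coset modulo the dihedral subgroup of p and q. *)
Lemma coset_minimal y p q : reduced (rcons y p) -> reduced (rcons y q) ->
  forall a e, all (pred2 p q) e -> cox y = cox (a ++ e) ->
  (size y <= size a)%N.
Proof.
move=> ryp ryq a e.
have [n] := ubnP (size (a ++ e)); elim: n a e => // n IH a e.
rewrite ltnS => sz pqe ye.
case rae: (reduced (a ++ e)); last first.
  have [v [ve sv /subseqP[m sm vm]]] := deletion (negbT rae).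
  move: vm; rewrite -(cat_take_drop (size a) m) mask_cat; last first.
    by rewrite size_take sm size_cat; case: ltngtP (leq_addr (size e) (size a)).
  set a' := mask _ a; set e' := mask _ e => vm.
  apply: (@leq_trans (size a')); last exact: size_subseq (mask_subseq _ _).
  apply: (IH a' e'); rewrite -?vm ?ve //.
    exact: leq_trans sv sz.
  apply/allP=> x /mem_mask; exact: (allP pqe).
have ry : reduced y by move: ryp; rewrite -cats1 => /reduced_catl.
have := reduced_size ry rae ye; rewrite size_cat.
case/lastP: e pqe ye {sz rae} => [|e x]; first by rewrite addn0 => _ _ ->.
rewrite all_rcons => /andP[xpq _]; rewrite -rcons_cat => ye sy.
have rx : reduced (rcons y x) by case/pred2P: xpq => ->.
have := reduced_rcons_le rx (v := a ++ e).
rewrite [cox (rcons y x)]cox_rcons ye cox_rcons.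
rewrite -mulgA cox_sq mulg1 => /(_ erefl); rewrite sy size_cat size_rcons.
by rewrite addnS ltnNge leqnSn.
Qed.

(** A reflection common to y and to the conjugated list of d would give, by
deletion in y, a shorter element of the same dihedral coset, against
[coset_minimal]. *)
Lemma reduced_cat_dihedral y p q d :
  reduced (rcons y p) -> reduced (rcons y q) ->
  all (pred2 p q) d -> reduced d -> reduced (y ++ d).
Proof.
move=> ryp ryq pqd rd; have ry : reduced y.
  by move: ryp; rewrite -cats1 => /reduced_catl.
rewrite /reduced refls_cat cat_uniq [uniq (refls y)]ry /=.
rewrite map_inj_uniq; last exact: conjg_inj.
rewrite [uniq _]rd andbT; apply/negP => /hasP[_ /mapP[r rr ->]].
case/reflsP: rr => d1 [t [d2 [dE ->]]] ry'.
have [v [yv sz _]] := refls_deletion ry'.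
move: yv; rewrite conjgE invgK -!mulgA mulVg mulg1 invgK => yv.
(* d1 t d1^-1 is an involution, and the reversed word d1 stands for d1^-1. *)
have yE : cox y = cox (v ++ (d1 ++ t :: rev d1)).
  rewrite !cox_cat -yv (cox_cons t (rev d1)) cox_rev -!mulgA mulKg.
  by rewrite cox_mulK mulgV mulg1.
have pqe : all (pred2 p q) (d1 ++ t :: rev d1).
  move: pqd; rewrite dE !all_cat /= => /and3P[d1a -> _].
  by rewrite d1a all_rev d1a.
by have := coset_minimal ryp ryq pqe yE; rewrite -sz ltnn.
Qed.

Lemma all_alternating p q k : all (pred2 p q) (alternating p q k).
Proof. by apply/allP=> x /mapP[i _ ->] /=; case: odd; rewrite eqxx ?orbT. Qed.

Lemma braid_cong s t m x : s <> t -> M s t = Some m ->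
  word_cong (braid_relation M)
    (alternating s t m ++ x) (alternating t s m ++ x).
Proof.
by move=> st Mst; exact: (@word_cong_step _ _ [::]) (BraidRelation st Mst).
Qed.

Lemma cong_cons s u v : word_cong (braid_relation M) u v ->
  word_cong (braid_relation M) (s :: u) (s :: v).
Proof. by move=> uv; apply: (word_cong_cat (word_cong_refl _ [:: s]) uv). Qed.

(** If the first letters s and t differ, both are descents, so the common
element has a reduced word starting with the braid word of s and t; it is
compared to u through its form starting with s, and to v through its form
starting with t. *)
Lemma matsumoto u v : reduced u -> reduced v -> cox u = cox v ->
  word_cong (braid_relation M) u v.
Proof.
have [n] := ubnP (size u); elim: n u v => // n IH [|s u] [|t v] un ru rv uv.
- exact: word_cong_refl.
- by have := reduced_size ru rv uv.
- by have := reduced_size ru rv uv.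
have ru' := reduced_cons ru; have rv' := reduced_cons rv.
have un' : (size u < n)%N by [].
have vn' : (size v < n)%N by move: (reduced_size ru rv uv) un => /= [<-].
case: (eqVneq s t) uv rv => [<-{t}|/eqP st] uv rv.
  apply/cong_cons/IH => //; apply: (mulgI (cox [:: s])); by rewrite -!cox_cons.
have tu : cox [:: t] \in refls (s :: u).
  by rewrite (reduced_mem ru rv uv) /= mem_head.
have [|m [x [Mst ux rx]]] := dihedral_prefix st ru _ tu; first exact: mem_head.
have m2 := cox_ge2 st Mst; case: m m2 Mst ux rx => // m _ Mst ux rx.
have vx : cox (t :: v) = cox (alternating t s m.+1 ++ x).
  by rewrite -uv ux !cox_cat (cox_braid st Mst).
have rx' : reduced (alternating t s m.+1 ++ x).
  apply: (reduced_of_size rv vx); rewrite -(reduced_size ru rv uv).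
  by rewrite (reduced_size ru rx ux) !size_cat !size_alternating.
apply: (@word_cong_trans _ _ _ (alternating s t m.+1 ++ x)).
  move: ux rx; rewrite alternatingS /= => ux rx; apply/cong_cons/IH => //.
    exact: reduced_cons rx.
  by apply: (mulgI (cox [:: s])); rewrite -!cox_cons.
apply: (@word_cong_trans _ _ _ (alternating t s m.+1 ++ x)).
  exact: braid_cong.
apply: word_cong_sym.
move: vx rx'; rewrite alternatingS /= => vx rx'; apply/cong_cons/IH => //.
  exact: reduced_cons rx'.
by apply: (mulgI (cox [:: t])); rewrite -!cox_cons.
Qed.

End CoxeterWords.

(** * Cancellation and least common multiples in the Artin monoid *)
Section ArtinCancellation.
Variables (S : choiceType) (M : coxeterMatrix S).
Local Notation A := (artinMonoid M).
Local Notation cox := (cox M).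
Local Notation reduced := (reduced M).
Local Notation refls := (refls M).
Implicit Types (s t p q : S) (u v w x y z X Y Z V : seq S).

Definition artin u : A := pres (braid_relation M) u.

Lemma artinE u v : artin u = artin v <-> word_cong (braid_relation M) u v.
Proof. exact: presE. Qed.

Lemma artin_cat u v : artin (u ++ v) = artin u * artin v.
Proof. exact: pres_catM. Qed.

Lemma artin_cons s u : artin (s :: u) = artin [:: s] * artin u.
Proof. exact: (artin_cat [:: s]). Qed.

Lemma artin_repr (a : A) : exists u, a = artin u.
Proof. by exists (repr a); rewrite /artin pres_repr. Qed.

Lemma artin_size u v : artin u = artin v -> size u = size v.
Proof.
by move=> uv; rewrite -[size u](alength_pres M) -[size v](alength_pres M);
  congr alength.
Qed.

Lemma artin_braid s t m : s <> t -> M s t = Some m ->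
  artin (alternating s t m) = artin (alternating t s m).
Proof.
move=> st Mst; apply/artinE.
by have := braid_cong [::] st Mst; rewrite !cats0.
Qed.

Lemma artin_cox u v : artin u = artin v -> cox u = cox v.
Proof.
move=> /artinE; elim=> {u v} [u a b v ab|//|u v _ -> //|u v w _ -> //].
by rewrite !cox_cat; case: ab => s t m st Mst; rewrite (cox_braid st Mst).
Qed.

Lemma artin_reduced u v : artin u = artin v -> reduced u -> reduced v.
Proof.
move=> uv ru; apply: (reduced_of_size ru (artin_cox uv)).
by rewrite (artin_size uv).
Qed.

Lemma artin_matsumoto s u v :
  reduced (s :: u) -> reduced (s :: v) -> cox (s :: u) = cox (s :: v) ->
  artin u = artin v.
Proof.
move=> ru rv; rewrite (cox_cons _ s u) (cox_cons _ s v) => /mulgI uv.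
apply/artinE/matsumoto => //.
  exact: reduced_cons ru.
exact: reduced_cons rv.
Qed.

(** What the equality s X = t Y should imply: s and t are equal and cancel, or
the common value is a multiple of the braid word of s and t.  The label is
k + 1, so that removing the first letter leaves an alternating word of length
k. *)
Definition lcm_factor s X t Y := (s = t /\ artin X = artin Y) \/
  (s <> t /\ exists k V, [/\ M s t = Some k.+1,
     artin X = artin (alternating t s k ++ V) &
     artin Y = artin (alternating s t k ++ V)]).

Lemma lcm_factor_sym s X t Y : lcm_factor s X t Y -> lcm_factor t Y s X.
Proof.
case=> [[-> XY]|[st [k [V [Mst XE YE]]]]]; first by left.
right; split; first exact: nesym.
by exists k, V; rewrite cox_sym.
Qed.

(** Stated for bounded length, because cancellation below length n is used to
reach length n. *)
Definition lcm_property n := forall s t X Y, (size X < n)%N ->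
  artin (s :: X) = artin (t :: Y) -> lcm_factor s X t Y.

Section Bounded.
Variables (n : nat) (lcm_n : lcm_property n).

Lemma artin_catI z X Y : (size (z ++ X) <= n)%N ->
  artin (z ++ X) = artin (z ++ Y) -> artin X = artin Y.
Proof.
elim: z => //= s z IH sz /(lcm_n sz)[[_ e]|[]//].
exact: IH (ltnW sz) e.
Qed.

Variables (t : S) (Y : seq S) (Yn : (size Y <= n)%N).

(** The words z such that t z is reduced and z divides Y.  The maximal one, of
which all others are prefixes up to braid relations, is the greatest reduced
divisor of Y that remains reduced after t. *)
Definition admissible z :=
  reduced (t :: z) /\ exists x, artin (z ++ x) = artin Y.

Lemma admissible_prefix z x : admissible (z ++ x) -> admissible z.
Proof.
case=> rz [y yY]; split; first exact: (@reduced_catl _ _ (t :: z) x).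
by exists (x ++ y); rewrite catA.
Qed.

Lemma admissible_artin z x : artin z = artin x -> admissible z -> admissible x.
Proof.
move=> zx [rz [y yY]]; split.
  by apply: artin_reduced rz; rewrite artin_cons zx -artin_cons.
by exists y; rewrite artin_cat -zx -artin_cat.
Qed.

(** Divisibility by z p and z q passes to the lcm by [lcm_n], and the lcm stays
reduced behind t by [reduced_cat_dihedral]. *)
Lemma admissible_join z p q : p <> q ->
  admissible (rcons z p) -> admissible (rcons z q) ->
  exists2 k, M p q = Some k.+1 & admissible (z ++ alternating p q k.+1).
Proof.
move=> pq [rp [Y1 Y1E]] [rq [Y2 Y2E]].
move: Y1E Y2E; rewrite !cat_rcons => Y1E Y2E.
have sz : (size (z ++ p :: Y1) <= n)%N by rewrite (artin_size Y1E).
have e := artin_catI sz (etrans Y1E (esym Y2E)).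
have sz1 : (size Y1 < n)%N.
  by apply: leq_trans sz; rewrite size_cat leq_addl.
case: (lcm_n sz1 e) => [[//]|[_ [k [V [Mpq Y1V _]]]]].
exists k => //; split.
  apply: (@reduced_cat_dihedral _ _ (t :: z) p q) => //.
    exact: all_alternating.
  by apply: alternating_reduced => // m; rewrite Mpq => -[<-].
exists V; rewrite -Y1E -catA alternatingS /= artin_cat (artin_cons p) -Y1V.
by rewrite -artin_cons -artin_cat.
Qed.

(** Newman's lemma for right extension: extensions are bounded in length by Y,
and [admissible_join] is local confluence. *)
Lemma admissible_confluence z (p1 p2 : seq S) :
  admissible (z ++ p1) -> admissible (z ++ p2) ->
  exists (q1 q2 : seq S), artin (z ++ p1 ++ q1) = artin (z ++ p2 ++ q2) /\
                admissible (z ++ p1 ++ q1).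
Proof.
have [N] := ubnP (size Y - size z).
elim: N z p1 p2 => // N IH z [|p p1] [|q p2] szN a1 a2.
- by exists [::], [::].
- by exists (q :: p2), [::]; rewrite (cats0 (q :: p2)).
- by exists [::], (p :: p1); rewrite (cats0 (p :: p1)).
have szS r x : admissible (z ++ r :: x) -> (size Y - size (rcons z r) < N)%N.
  move=> [_ [y /artin_size]]; rewrite -catA size_cat /= addnS => szY.
  have : (0 < size Y - size z)%N by rewrite subn_gt0 -szY ltnS leq_addr.
  by rewrite size_rcons subnS; case: (size Y - size z)%N szN.
have ap : admissible (rcons z p).
  by apply: (@admissible_prefix _ p1); rewrite cat_rcons.
have aq : admissible (rcons z q).
  by apply: (@admissible_prefix _ p2); rewrite cat_rcons.
case: (eqVneq p q) a1 a2 => [<-{q aq}|/eqP pq] a1 a2.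
  have := IH (rcons z p) p1 p2 (szS _ _ a1); rewrite !cat_rcons => /(_ a1 a2).
  by case=> q1 [q2]; rewrite !cat_rcons => h; exists q1, q2.
have [k Mpq] := admissible_join pq ap aq; rewrite alternatingS => ad.
(* Close the square at z with the braid word of p and q, then complete the
   diamonds at z p and, with the other form of the braid word, at z q. *)
have [a [b []]] : exists a b,
    artin (z ++ p :: p1 ++ a) = artin (z ++ alternating p q k.+1 ++ b) /\
    admissible (z ++ p :: p1 ++ a).
  have := IH (rcons z p) p1 (alternating q p k) (szS _ _ a1).
  rewrite !cat_rcons => /(_ a1 ad) [a [b]]; rewrite !cat_rcons => h.
  by exists a, b; rewrite alternatingS.
rewrite (artin_cat z (alternating _ _ _ ++ _)) (artin_cat (alternating _ _ _)).
rewrite (artin_braid pq Mpq) -!artin_cat alternatingS /= => ab adm_a.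
have adm_b := admissible_artin ab adm_a.
have := IH (rcons z q) (alternating p q k ++ b) p2 (szS _ _ a2).
rewrite !cat_rcons => /(_ adm_b a2) [c [d]]; rewrite !cat_rcons => -[cd adm_c].
have e : artin (z ++ (p :: p1) ++ a ++ c) =
         artin (z ++ q :: (alternating p q k ++ b) ++ c).
  have := congr1 (fun g : A => g * artin c) ab; rewrite -!artin_cat.
  by rewrite -!catA /= -!catA.
exists (a ++ c), d; rewrite e; split=> //.
exact: admissible_artin (esym e) adm_c.
Qed.

(** When s, t, u are distinct, let t P and t Q be the braid words of (s, t) and
of (u, t).  Both P and Q are admissible, so they have a common admissible
extension z, and the reduced word t z has both s and u as left descents. *)
Lemma lcm_factor_trans s (u : S) X Z :
  lcm_factor s X t Y -> lcm_factor t Y u Z -> lcm_factor s X u Z.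
Proof.
case=> [[-> XY]|[st [k [V [Mst XE YE]]]]].
  case=> [[<- YZ]|[tu [l [V' [Mtu YE' ZE]]]]]; first by left; rewrite XY.
  by right; split=> //; exists l, V'; rewrite XY.
case=> [[<- YZ]|[tu [l [V' [Mtu YE' ZE]]]]].
  by right; split=> //; exists k, V; rewrite -YZ.
case: (eqVneq s u) => [su|/eqP su].
  (* Both factorizations of Y now have the same first factor. *)
  left; split=> //; move: Mtu YE' ZE; rewrite -su cox_sym Mst => -[<-] YE' ZE.
  rewrite XE ZE !artin_cat; congr (_ * _).
  apply: (artin_catI (z := alternating s t k)); last by rewrite -YE.
  by rewrite -(artin_size YE).
have aP : admissible (alternating s t k).
  split; last by exists V.
  rewrite -alternatingS; apply: alternating_reduced; first exact: nesym.
  by move=> m; rewrite cox_sym Mst => -[<-].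
have aQ : admissible (alternating u t l).
  split; last by exists V'.
  rewrite -alternatingS; apply: alternating_reduced => // m.
  by rewrite Mtu => -[<-].
have [q1 [q2 [/= q12 [rd [y yY]]]]] := @admissible_confluence [::] _ _ aP aQ.
have VE : artin V = artin (q1 ++ y).
  apply: (artin_catI (z := alternating s t k)).
    by rewrite -(artin_size YE).
  by rewrite catA yY YE.
have VE' : artin V' = artin (q2 ++ y).
  apply: (artin_catI (z := alternating u t l)).
    by rewrite -(artin_size YE').
  by rewrite -YE' -yY catA [LHS]artin_cat q12 -artin_cat.
set d := t :: _ in rd.
have ds : cox d = cox (s :: alternating t s k ++ q1).
  rewrite /d -cat_cons -alternatingS -cat_cons -alternatingS.
  by rewrite cox_cat (cox_cat M (alternating s t _)) (cox_braid st Mst).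
have rs : reduced (s :: alternating t s k ++ q1).
  by apply: (reduced_of_size rd ds); rewrite /= !size_cat !size_alternating.
have du : cox d = cox (u :: alternating t u l ++ q2).
  rewrite /d cox_cons (artin_cox q12) -cox_cons.
  rewrite -cat_cons -alternatingS -cat_cons -alternatingS.
  by rewrite cox_cat (cox_cat M (alternating u t _)) (cox_braid tu Mtu).
have ru : reduced (u :: alternating t u l ++ q2).
  apply: (reduced_of_size rd du); rewrite /d /= (artin_size q12).
  by rewrite !size_cat !size_alternating.
(* s and u are left descents of d, so d starts with their braid word. *)
have [||m [x [Msu dE rx]]] := dihedral_prefix su rd.
- by rewrite (reduced_mem rd rs ds) mem_head.
- by rewrite (reduced_mem rd ru du) mem_head.
have m2 := cox_ge2 su Msu; case: m m2 Msu dE rx => // j _ Msu dE rx.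
have dE' : cox d = cox (alternating u s j.+1 ++ x).
  by rewrite dE !cox_cat (cox_braid su Msu).
have rx' : reduced (alternating u s j.+1 ++ x).
  apply: (reduced_of_size rx); first by rewrite -dE dE'.
  by rewrite !size_cat !size_alternating.
move: dE dE' rx rx'; rewrite !alternatingS /= => dE dE' rx rx'.
have e1 := artin_matsumoto rs rx (etrans (esym ds) dE).
have e2 := artin_matsumoto ru rx' (etrans (esym du) dE').
right; split=> //; exists j, (x ++ y); split=> //.
  by rewrite XE artin_cat VE -artin_cat catA [LHS]artin_cat e1 -artin_cat -catA.
by rewrite ZE artin_cat VE' -artin_cat catA [LHS]artin_cat e2 -artin_cat -catA.
Qed.

End Bounded.

(** Only a braid move at the start of a word changes its first letter, and there
the conclusion holds by construction; [lcm_factor_trans] composes the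
moves. *)
Theorem artin_lcm_property n : lcm_property n.
Proof.
elim: n => // n lcm_n s t X Y; rewrite ltnS => Xn /artinE.
set u := s :: X; set v := t :: Y => uv.
suff: forall s t X Y, u = s :: X -> v = t :: Y -> (size X <= n)%N ->
    lcm_factor s X t Y by apply.
move: uv; rewrite {}/u {}/v; move: (s :: X) (t :: Y) => u v.
elim=> {s t X Y Xn u v} [w a b v ab|u|u v uv IH|u v w uv IHuv vw IHvw] s t X Y.
- case: w => [|c w] /=.
    case: ab => p q k pq Mpq; have k2 := cox_ge2 pq Mpq.
    case: k k2 Mpq => // k _ Mpq; rewrite !alternatingS => -[<- <-] [<- <-] _.
    by right; split=> //; exists k, v.
  move=> [<- <-] [<- <-] _; left; split=> //; apply/artinE.
  exact: word_cong_step.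
- by move=> -> [-> ->]; left.
- move=> vE uE Xn; apply: lcm_factor_sym; apply: IH => //.
  by move/artinE/artin_size: uv; rewrite uE vE => -[->].
- move=> uE wE Xn; move/artinE/artin_size: uv; rewrite uE.
  case: v vw IHuv IHvw => // r R _ IHuv IHvw [sz].
  have Rn : (size R <= n)%N by rewrite -sz.
  exact: (lcm_factor_trans lcm_n Rn) (IHuv s r X R uE erefl Xn)
    (IHvw r t R Y erefl wE Rn).
Qed.

Theorem artin_mulI : right_injective (@mul A).
Proof.
move=> a b c; case: (artin_repr a) => z ->; case: (artin_repr b) => X ->.
case: (artin_repr c) => Y ->; rewrite -!artin_cat => e.
exact (artin_catI (@artin_lcm_property (size (z ++ X))) (leqnn _) e).
Qed.

Lemma agen_inj : injective (@agen S M).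
Proof.
move=> s t st.
case: (@artin_lcm_property 1 s t [::] [::] isT st) => [[]//|].
case=> nst [k [V [Mst e _]]].
have := artin_size e; rewrite size_cat size_alternating.
by have := cox_ge2 nst Mst; case: k {Mst e}.
Qed.

(** The lcm of s and t is s t ..., of length at least 2, so after cancelling s
the next letter is t. *)
Lemma agen_ldiv_mul s t a :
  s <> t -> ldiv (agen M t) (agen M s * a) -> ldiv (agen M t) a.
Proof.
move=> st [b]; case: (artin_repr a) => X ->; case: (artin_repr b) => Y ->.
rewrite -[agen M s]/(artin [:: s]) -[agen M t]/(artin [:: t]) -!artin_cons.
case/(@artin_lcm_property (size X).+1 _ _ _ _ (leqnn _)) => [[]//|].
case=> _ [k [V [Mst -> _]]]; have := cox_ge2 st Mst; case: k {Mst} => // k _.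
by exists (artin (alternating s t k ++ V)); rewrite alternatingS -artin_cons.
Qed.

End ArtinCancellation.

(** * Divisibility by generators and commutation past a word *)
Section Divisibility.
Variables (S : choiceType) (M : coxeterMatrix S).
Local Notation A := (artinMonoid M).
Implicit Types (a b c : A).

Lemma ldiv_mulr a b c : ldiv a b -> ldiv a (b * c).
Proof. by case=> d ->; exists (d * c); rewrite mulgA. Qed.

Lemma alengthM a b : alength (a * b) = (alength a + alength b)%N.
Proof.
case: (artin_repr a) => u ->; case: (artin_repr b) => v ->.
by rewrite -artin_cat !alength_pres size_cat.
Qed.

Lemma alength_eq0 a : alength a = 0%N -> a = 1.
Proof.
by case: (artin_repr a) => u ->; rewrite alength_pres => /size0nil ->.
Qed.

Lemma agen_ldiv_word t u a :
  t \notin u -> ldiv (agen M t) (artin M u * a) -> ldiv (agen M t) a.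
Proof.
elim: u => [|s u IH]; first by rewrite mul1g.
rewrite inE negb_or eq_sym => /andP[/eqP st tu].
by rewrite artin_cons -mulgA => /(agen_ldiv_mul st)/IH; apply.
Qed.

(** In the application a is U and f is the inclusion of the old generators: this
is how D' moves through U. *)
Lemma artin_conj_map (T : Type) (f g : T -> S) a :
  (forall i, agen M (f i) * a = a * agen M (g i)) ->
  forall u, artin M (map f u) * a = a * artin M (map g u).
Proof.
move=> fg; elim=> [|i u IH] /=; first by rewrite mul1g mulg1.
by rewrite artin_cons (artin_cons M (g i)) -mulgA IH !mulgA fg.
Qed.

End Divisibility.

Lemma artin_mapM (S T : choiceType) (M : coxeterMatrix S) (N : coxeterMatrix T)
    (f : S -> T) (finj : injective f) (fM : forall s t, N (f s) (f t) = M s t)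
    (a b : artinMonoid M) :
  artin_map N f (a * b) = artin_map N f a * artin_map N f b.
Proof.
case: (artin_repr a) => u ->; case: (artin_repr b) => v ->.
rewrite -artin_cat !artin_map_pres // map_cat; exact: artin_cat.
Qed.

Lemma old_inj n : injective (@old n).
Proof. by move=> i j /(congr1 val) /= /val_inj. Qed.

Lemma old_neq_max n (i : 'I_n) : old i != ord_max.
Proof. by rewrite -val_eqE /= ltn_eqF. Qed.

Lemma ord_oldP n (j : 'I_n.+1) : j = ord_max \/ exists i, j = @old n i.
Proof.
case: (ltnP j n) => [jn|nj]; [right|left].
  by exists (Ordinal jn); apply: val_inj.
by apply: val_inj => /=; apply/eqP; rewrite eqn_leq nj -ltnS ltn_ord.
Qed.

(** * Characterization of the relative Garside element *)

Theorem proposition3 (n : nat) (hn : (2 <= n.+1)%N)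
    (G' : coxeterMatrix 'I_n) (G : coxeterMatrix 'I_n.+1)
    (hincl : full_subgraph G' G)
    (hG' : spherical G') (hG : spherical G)
    (D' : artinMonoid G') (hD' : is_garside D')
    (D : artinMonoid G) (hD : is_garside D)
    (R : artinMonoid G) (hR : D = artin_incl G D' * R)
    (sigma_n : {perm 'I_n.+1})
    (hsigma_n : forall i, agen G i * D = D * agen G (sigma_n i))
    (m : 'I_n.+1) (hm : m = sigma_n ord_max)
    (sigma : 'I_n -> 'I_n.+1) (hsigma : conj_old R m sigma)
    (U : artinMonoid G)
    (ha : ldiv (agen G ord_max) U)
    (k : 'I_n.+1) (tau : 'I_n -> 'I_n.+1) (hb : conj_old U k tau)
    (hc : forall V : artinMonoid G, ldiv (agen G ord_max) V ->
       (exists (l : 'I_n.+1) (t : 'I_n -> 'I_n.+1), conj_old V l t) ->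
       (alength U <= alength V)%N) :
  U = R /\ k = m /\ tau = sigma.
Proof.
have [w D'E] := artin_repr D'.
have inclE : artin_incl G D' = artin G (map (@old n) w).
  rewrite D'E; apply: artin_map_pres => //; exact: old_inj.
have new_R : ldiv (agen G ord_max) R.
  apply: (@agen_ldiv_word _ _ _ (map (@old n) w)); last first.
    by rewrite -inclE -hR; apply: hD.1.
  by apply/mapP => -[i _ /eqP]; rewrite eq_sym (negPf (old_neq_max i)).
have [z D'U] : ldiv D (artin_incl G D' * U).
  apply: hD.2 => j; case: (ord_oldP j) => [->|[i ->]].
    by rewrite inclE (artin_conj_map hb.2); apply: ldiv_mulr.
  apply: ldiv_mulr; have [b ->] := hD'.1 i; exists (artin_incl G b).
  rewrite /artin_incl artin_mapM ?artin_map_pres //; exact: old_inj.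
have URz : U = R * z by move: D'U; rewrite hR -mulgA => /artin_mulI.
have z1 : z = 1.
  apply: alength_eq0; apply/eqP; rewrite -leqn0 -(leq_add2l (alength R)) addn0.
  by rewrite -alengthM -URz; apply: hc => //; exists m, sigma.
have UR : U = R by rewrite URz z1 mulg1.
have st : tau = sigma.
  apply/funext => i; apply: (@agen_inj _ G); apply: (@artin_mulI _ _ R).
  by rewrite -hsigma.2 -{1}UR -hb.2 UR.
split=> //; split=> //.
apply: contrapT => km; have [_ _ surj] := hsigma.1.
have [i _ sik] := surj k km.
by have [fun_tau _ _] := hb.1; apply: (fun_tau i I); rewrite st.
Qed.
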